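(* Let $n\ge2$, let $(\mathcal{A},[\cdot,\dots,\cdot],\alpha)$ be a (multiplicative) $n$-Hom-Lie superalgebra, $(V,\rho,\alpha_V)$ a representation of it, and $T:V\to\mathcal{A}$ an $\mathcal{O}$-operator associated to $(V,\rho,\alpha_V)$. Then $$\{u_1,\dots,u_n\}_T=\rho(Tu_1,\dots,Tu_{n-1})u_n,\qquad u_1,\dots,u_n\in V,$$ defines an $n$-Hom-pre-Lie superalgebra $(V,\{\cdot,\dots,\cdot\}_T,\alpha_V)$. In particular, if $P:\mathcal{A}\to\mathcal{A}$ is a Rota-Baxter operator of weight zero on $(\mathcal{A},[\cdot,\dots,\cdot],\alpha)$ (i.e. an $\mathcal{O}$-operator associated to the adjoint representation $(\mathcal{A},ad,\alpha)$, $ad(x_1,\dots,x_{n-1})x=[x_1,\dots,x_{n-1},x]$), then $\{x_1,\dots,x_n\}_P=[P(x_1),\dots,P(x_{n-1}),x_n]$ defines an $n$-Hom-pre-Lie superalgebra $(\mathcal{A},\{\cdot,\dots,\cdot\}_P,\alpha)$.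
   Context: Conventions. $\mathbb{K}$ is an algebraically closed field of characteristic $0$; all vector spaces are over $\mathbb{K}$ and $\mathbb{Z}_2$-graded. $|x|$ is the degree of a homogeneous element; formulas involving degrees are for homogeneous elements. For a tuple $X=(x_1,x_2,\dots)$ put $|X|_i^j=\sum_{k=i}^j|x_k|$ (zero if $j<i$), similarly for $Y,U$. A hat means omission. A (multi)linear map is even if it preserves degree. Super-skew-symmetric in some consecutive arguments: exchanging adjacent $x_i,x_{i+1}$ among them multiplies the value by $-(-1)^{|x_i||x_{i+1}|}$. (Multiplicative) $n$-Hom-Lie superalgebra: $(\mathcal{A},[\cdot,\dots,\cdot],\alpha)$ with $[\cdot,\dots,\cdot]$ an even super-skew-symmetric $n$-linear map, $\alpha$ even linear, $\alpha([x_1,\dots,x_n])=[\alpha(x_1),\dots,\alpha(x_n)]$ and $[\alpha(x_1),\dots,\alpha(x_{n-1}),[y_1,\dots,y_n]]=\sum_{i=1}^n(-1)^{|X|_1^{n-1}|Y|_1^{i-1}}[\alpha(y_1),\dots,\alpha(y_{i-1}),[x_1,\dots,x_{n-1},y_i],\alpha(y_{i+1}),\dots,\alpha(y_n)]$. Representation $(V,\rho,\alpha_V)$: $\rho:\mathcal{A}^{n-1}\to gl(V)$ even super-skew-symmetric multilinear, $\alpha_V:V\to V$ even linear with (a) $\rho(\alpha(x_1),\dots,\alpha(x_{n-1}))\alpha_V=\alpha_V\rho(x_1,\dots,x_{n-1})$; (b) $\rho(\alpha(x_1),\dots,\alpha(x_{n-1}))\rho(y_1,\dots,y_{n-1})-(-1)^{|X|_1^{n-1}|Y|_1^{n-1}}\rho(\alpha(y_1),\dots,\alpha(y_{n-1}))\rho(x_1,\dots,x_{n-1})=\sum_{i=1}^{n-1}(-1)^{|X|_1^{n-1}|Y|_1^{i-1}}\rho(\alpha(y_1),\dots,[x_1,\dots,x_{n-1},y_i],\dots,\alpha(y_{n-1}))\alpha_V$;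 (c) $\rho(\alpha(x_1),\dots,\alpha(x_{n-2}),[y_1,\dots,y_n])\alpha_V=\sum_{i=1}^n(-1)^{n-i}(-1)^{|X|_1^{n-2}(|Y|_1^n+|y_i|)+|y_i||Y|_{i+1}^n}\rho(\alpha(y_1),\dots,\widehat{\alpha(y_i)},\dots,\alpha(y_n))\rho(x_1,\dots,x_{n-2},y_i)$. $\mathcal{O}$-operator associated to $(V,\rho,\alpha_V)$: an even linear map $T:V\to\mathcal{A}$ with $\alpha\circ T=T\circ\alpha_V$ and $[Tu_1,\dots,Tu_n]=T\big(\sum_{i=1}^n(-1)^{n-i}(-1)^{|u_i||U|_{i+1}^n}\rho(Tu_1,\dots,\widehat{Tu_i},\dots,Tu_n)(u_i)\big)$. $n$-Hom-pre-Lie superalgebra: $(W,\{\cdot,\dots,\cdot\},\beta)$ with $\{\cdot,\dots,\cdot\}$ even $n$-linear, super-skew-symmetric in the first $n-1$ arguments, $\beta$ even linear, such that $$\{\beta(x_1),\dots,\beta(x_{n-1}),\{y_1,\dots,y_n\}\}=\sum_{i=1}^{n-1}(-1)^{|X|_1^{n-1}|Y|_1^{i-1}}\{\beta(y_1),\dots,[x_1,\dots,x_{n-1},y_i]^C,\dots,\beta(y_n)\}+(-1)^{|X|_1^{n-1}|Y|_1^{n-1}}\{\beta(y_1),\dots,\beta(y_{n-1}),\{x_1,\dots,x_{n-1},y_n\}\},$$ $$\{[x_1,\dots,x_n]^C,\beta(y_1),\dots,\beta(y_{n-1})\}=\sum_{i=1}^n(-1)^{n-i}(-1)^{|x_i||X|_{i+1}^n}\{\beta(x_1),\dots,\widehat{\beta(x_i)},\dots,\beta(x_n),\{x_i,y_1,\dots,y_{n-1}\}\},$$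 where $[x_1,\dots,x_n]^C=\sum_{i=1}^n(-1)^{n-i}(-1)^{|x_i||X|_{i+1}^n}\{x_1,\dots,\widehat{x_i},\dots,x_n,x_i\}$. *)

(* Defs.v *)
From mathcomp Require Import all_boot all_order all_algebra all_fingroup.

Set Implicit Arguments.
Unset Strict Implicit.
Unset Printing Implicit Defensive.

Import GRing.Theory.
Local Open Scope ring_scope.

(* Z_2-graded vector space, of arbitrary dimension: [homog d] is the subspace
   of elements of degree d, with [false] for even and [true] for odd.
   The zero vector is homogeneous of both degrees. *)
Record superspace (K : fieldType) := Superspace {
  carrier :> lmodType K;
  homog : bool -> carrier -> Prop;
  homog0 : forall d, homog d 0;
  homogP : forall d (a : K) u v,
    homog d u -> homog d v -> homog d (a *: u + v);
  homog_add : forall v, exists u0 u1,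
    [/\ homog false u0, homog true u1 & v = u0 + u1];
  homog_cap : forall v, homog false v -> homog true v -> v = 0
}.

Section Tuples.
Variable (E : Type).

Definition snoc m (x : {ffun 'I_m -> E}) (z : E) : {ffun 'I_m.+1 -> E} :=
  [ffun i => oapp x z (unlift ord_max i)].

Definition fcons m (z : E) (x : {ffun 'I_m -> E}) : {ffun 'I_m.+1 -> E} :=
  [ffun i => oapp x z (unlift ord0 i)].

Definition omit m (i : 'I_m.+1) (x : {ffun 'I_m.+1 -> E}) :
    {ffun 'I_m -> E} :=
  [ffun j => x (lift i j)].

Definition init m (x : {ffun 'I_m.+1 -> E}) : {ffun 'I_m -> E} :=
  omit ord_max x.

Definition upd m (x : {ffun 'I_m -> E}) (i : 'I_m) (z : E) :
    {ffun 'I_m -> E} :=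
  [ffun j => if j == i then z else x j].

Definition swap m (x : {ffun 'I_m -> E}) (i j : 'I_m) : {ffun 'I_m -> E} :=
  [ffun l => x (tperm i j l)].

Definition fmap (F : Type) (f : E -> F) m (x : {ffun 'I_m -> E}) :
    {ffun 'I_m -> F} :=
  [ffun j => f (x j)].

End Tuples.

(* A family of degrees is d : {ffun 'I_m -> bool}; the partial sums are natural
   numbers, used only through their parity.  Indices start at 0, so with the
   1-based notation |X|_i^j, [deg_lt d i] is |X|_1^i (the first i entries) and
   [deg_gt d i] is |X|_{i+2}^m (the entries after the one of index i). *)
Definition deg m (d : {ffun 'I_m -> bool}) : nat := (\sum_(l < m) d l)%N.
Definition deg_lt m (d : {ffun 'I_m -> bool}) (i : nat) : nat :=
  (\sum_(l < m | l < i) d l)%N.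
Definition deg_gt m (d : {ffun 'I_m -> bool}) (i : nat) : nat :=
  (\sum_(l < m | i < l) d l)%N.

Section Maps.
Variables (K : fieldType) (U W : superspace K).

(* Degrees are passed explicitly: every formula involving degrees is stated for
   all x and all d such that x is homogeneous with degrees d. *)
Definition homogs m (d : {ffun 'I_m -> bool}) (x : {ffun 'I_m -> U}) : Prop :=
  forall i, homog (d i) (x i).

Definition even_map (f : U -> W) : Prop :=
  forall d u, homog d u -> homog d (f u).

Definition even_multi m (f : {ffun 'I_m -> U} -> W) : Prop :=
  forall d x, homogs d x -> homog (odd (deg d)) (f x).

Definition multilinear m (f : {ffun 'I_m -> U} -> W) : Prop :=
  forall (x : {ffun 'I_m -> U}) (i : 'I_m) (a : K) (u v : U),
    f (upd x i (a *: u + v)) = a *: f (upd x i u) + f (upd x i v).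

(* super-skew-symmetry in the first p arguments *)
Definition super_skew (p m : nat) (f : {ffun 'I_m -> U} -> W) : Prop :=
  forall (i j : 'I_m), j = i.+1 :> nat -> (j < p)%N ->
  forall (x : {ffun 'I_m -> U}) (a b : bool),
    homog a (x i) -> homog b (x j) ->
    f (swap x i j) = - ((-1) ^+ (a * b) : K) *: f x.

End Maps.

(* Below the arity is n = k.+2, so that k ranging over nat is n >= 2 ranging
   over nat; n - 1 is k.+1 and n - 2 is k.  With the index i starting at 0, the
   sign (-1)^(n-i) of the 1-based formulas becomes (-1)^(k.+1 - i). *)

Section HomLie.
Variables (K : fieldType) (k : nat) (A : superspace K).

Record n_hom_lie (br : {ffun 'I_k.+2 -> A} -> A) (alpha : {linear A -> A}) :
    Prop := NHomLie {
  hl_linear : multilinear br;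
  hl_even : even_multi br;
  hl_skew : super_skew k.+2 br;
  hl_alpha_even : even_map alpha;
  hl_mult : forall x, alpha (br x) = br (fmap alpha x);
  hl_jacobi : forall dx (x : {ffun 'I_k.+1 -> A})
                     dy (y : {ffun 'I_k.+2 -> A}),
    homogs dx x -> homogs dy y ->
    br (snoc (fmap alpha x) (br y)) =
    \sum_(i < k.+2) ((-1) ^+ (deg dx * deg_lt dy i) : K) *:
      br (upd (fmap alpha y) i (br (snoc x (y i))))
}.

Definition adjoint (br : {ffun 'I_k.+2 -> A} -> A)
    (x : {ffun 'I_k.+1 -> A}) (z : A) : A :=
  br (snoc x z).

End HomLie.

Section Representation.
Variables (K : fieldType) (k : nat) (A V : superspace K).

(* rho takes values in gl(V) by [rep_endo]; linearity, evenness and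
   skew-symmetry of rho are those of its values at the vectors of V. *)
Record representation (br : {ffun 'I_k.+2 -> A} -> A) (alpha : {linear A -> A})
    (rho : {ffun 'I_k.+1 -> A} -> V -> V) (alphaV : {linear V -> V}) :
    Prop := Representation {
  rep_endo : forall x, linear (rho x);
  rep_linear : forall v, multilinear (fun x => rho x v);
  rep_even : forall dx x e v, homogs dx x -> homog e v ->
    homog (odd (deg dx + e)) (rho x v);
  rep_skew : forall v, super_skew k.+1 (fun x => rho x v);
  rep_alphaV_even : even_map alphaV;
  rep_a : forall x v,
    rho (fmap alpha x) (alphaV v) = alphaV (rho x v);
  rep_b : forall dx (x : {ffun 'I_k.+1 -> A})
                 dy (y : {ffun 'I_k.+1 -> A}) (v : V),
    homogs dx x -> homogs dy y ->
    rho (fmap alpha x) (rho y v)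
      - ((-1) ^+ (deg dx * deg dy) : K) *: rho (fmap alpha y) (rho x v) =
    \sum_(i < k.+1) ((-1) ^+ (deg dx * deg_lt dy i) : K) *:
      rho (upd (fmap alpha y) i (br (snoc x (y i)))) (alphaV v);
  rep_c : forall dx (x : {ffun 'I_k -> A})
                 dy (y : {ffun 'I_k.+2 -> A}) (v : V),
    homogs dx x -> homogs dy y ->
    rho (snoc (fmap alpha x) (br y)) (alphaV v) =
    \sum_(i < k.+2)
      ((-1) ^+ (k.+1 - i)
       * (-1) ^+ (deg dx * (deg dy + dy i) + dy i * deg_gt dy i) : K) *:
      rho (fmap alpha (omit i y)) (rho (snoc x (y i)) v)
}.

Record O_operator (br : {ffun 'I_k.+2 -> A} -> A) (alpha : {linear A -> A})
    (rho : {ffun 'I_k.+1 -> A} -> V -> V) (alphaV : {linear V -> V})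
    (T : {linear V -> A}) : Prop := OOperator {
  oop_even : even_map T;
  oop_comm : forall v, alpha (T v) = T (alphaV v);
  oop_eq : forall du (u : {ffun 'I_k.+2 -> V}), homogs du u ->
    br (fmap T u) =
    T (\sum_(i < k.+2)
         ((-1) ^+ (k.+1 - i) * (-1) ^+ (du i * deg_gt du i) : K) *:
         rho (fmap T (omit i u)) (u i))
}.

End Representation.

Definition rota_baxter0 (K : fieldType) (k : nat) (A : superspace K)
    (br : {ffun 'I_k.+2 -> A} -> A) (alpha P : {linear A -> A}) : Prop :=
  O_operator br alpha (adjoint br) alpha P.

Section HomPreLie.
Variables (K : fieldType) (k : nat) (W : superspace K).

(* [x_1, ..., x_n]^C for x homogeneous with degrees d *)
Definition c_bracket (pr : {ffun 'I_k.+2 -> W} -> W)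
    (d : {ffun 'I_k.+2 -> bool}) (x : {ffun 'I_k.+2 -> W}) : W :=
  \sum_(i < k.+2) ((-1) ^+ (k.+1 - i) * (-1) ^+ (d i * deg_gt d i) : K) *:
    pr (snoc (omit i x) (x i)).

Record n_hom_pre_lie (pr : {ffun 'I_k.+2 -> W} -> W)
    (beta : {linear W -> W}) : Prop := NHomPreLie {
  pl_linear : multilinear pr;
  pl_even : even_multi pr;
  pl_skew : super_skew k.+1 pr;
  pl_beta_even : even_map beta;
  (* [lift ord_max i] is i : 'I_k.+1 seen in 'I_k.+2 *)
  pl_left : forall dx (x : {ffun 'I_k.+1 -> W})
                   dy (y : {ffun 'I_k.+2 -> W}),
    homogs dx x -> homogs dy y ->
    pr (snoc (fmap beta x) (pr y)) =
    \sum_(i < k.+1) ((-1) ^+ (deg dx * deg_lt dy i) : K) *: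
      pr (upd (fmap beta y) (lift ord_max i)
           (c_bracket pr (snoc dx (dy (lift ord_max i)))
                         (snoc x (y (lift ord_max i)))))
    + ((-1) ^+ (deg dx * deg_lt dy k.+1) : K) *:
      pr (snoc (fmap beta (init y)) (pr (snoc x (y ord_max))));
  pl_right : forall dx (x : {ffun 'I_k.+2 -> W}) dy (y : {ffun 'I_k.+1 -> W}),
    homogs dx x -> homogs dy y ->
    pr (fcons (c_bracket pr dx x) (fmap beta y)) =
    \sum_(i < k.+2) ((-1) ^+ (k.+1 - i) * (-1) ^+ (dx i * deg_gt dx i) : K) *:
      pr (snoc (fmap beta (omit i x)) (pr (fcons (x i) y)))
}.

End HomPreLie.

(* Main.v *)
(** Composing rho with T turns axiom (b) of a representation into the first
    n-Hom-pre-Lie identity, because T maps the C-bracket to the bracket of A by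
    the O-operator equation. The second identity is axiom (c) after a bracket
    in the last argument of rho is moved to the first place; the signs produced
    on both sides of (c) by this move cancel modulo 2.
    The Rota-Baxter case is the case of the adjoint representation, whose
    axioms (b) and (c) both come from the Hom-Jacobi identity: (b) directly, and
    (c) by exchanging the last two arguments. *)

Require Import Defs.
From mathcomp Require Import all_boot all_order all_algebra all_fingroup zify.

Set Implicit Arguments.
Unset Strict Implicit.
Unset Printing Implicit Defensive.

Import GRing.Theory.
Local Open Scope ring_scope.

(** * Compatibility of the tuple operations *)

Section TupleLemmas.
Variables (E F : Type).

Lemma snoc_lift m (x : {ffun 'I_m -> E}) z i : snoc x z (lift ord_max i) = x i.
Proof. by rewrite ffunE liftK. Qed.

Lemma snoc_max m (x : {ffun 'I_m -> E}) z : snoc x z ord_max = z.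
Proof. by rewrite ffunE unlift_none. Qed.

Lemma fcons0 m (x : {ffun 'I_m -> E}) z : fcons z x ord0 = z.
Proof. by rewrite ffunE unlift_none. Qed.

Lemma omit0_fcons m (x : {ffun 'I_m -> E}) z : omit ord0 (fcons z x) = x.
Proof. by apply/ffunP => i; rewrite !ffunE liftK. Qed.

Lemma initE m (x : {ffun 'I_m.+1 -> E}) i : init x i = x (lift ord_max i).
Proof. by rewrite ffunE. Qed.

Lemma init_snoc m (x : {ffun 'I_m -> E}) z : init (snoc x z) = x.
Proof. by apply/ffunP => i; rewrite ffunE snoc_lift. Qed.

Lemma snoc_init m (x : {ffun 'I_m.+1 -> E}) : snoc (init x) (x ord_max) = x.
Proof.
apply/ffunP => i; case: (unliftP ord_max i) => [j|] ->.
  by rewrite snoc_lift ffunE.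
by rewrite snoc_max.
Qed.

Lemma init_fcons m (x : {ffun 'I_m.+1 -> E}) z :
  init (fcons z x) = fcons z (init x).
Proof.
apply/ffunP => i; rewrite initE; case: (unliftP ord0 i) => [j|] ->.
  have -> : lift ord_max (lift ord0 j) = lift ord0 (lift ord_max j).
    by apply/val_inj; rewrite /= /bump; have := ltn_ord j; lia.
  by rewrite !ffunE !liftK /= ffunE.
have -> : lift ord_max ord0 = ord0 :> 'I_m.+2 by apply/val_inj.
by rewrite !fcons0.
Qed.

Lemma fcons_max m (x : {ffun 'I_m.+1 -> E}) z :
  fcons z x ord_max = x ord_max.
Proof.
have -> : ord_max = lift ord0 ord_max :> 'I_m.+2 by apply/val_inj.
by rewrite ffunE liftK.
Qed.

Lemma upd_snoc m (x : {ffun 'I_m -> E}) i z v :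
  upd (snoc x v) (lift ord_max i) z = snoc (upd x i z) v.
Proof.
apply/ffunP => j; rewrite ffunE; case: (unliftP ord_max j) => [l|] ->.
  by rewrite !snoc_lift ffunE (inj_eq lift_inj).
by rewrite !snoc_max eq_liftF.
Qed.

Lemma upd_snoc_max m (x : {ffun 'I_m -> E}) z v :
  upd (snoc x v) ord_max z = snoc x z.
Proof.
apply/ffunP => j; rewrite ffunE; case: (unliftP ord_max j) => [l|] ->.
  by rewrite !snoc_lift eq_sym eq_liftF.
by rewrite !snoc_max eqxx.
Qed.

Lemma omit_upd m (x : {ffun 'I_m.+1 -> E}) i z : omit i (upd x i z) = omit i x.
Proof. by apply/ffunP => j; rewrite !ffunE eq_sym eq_liftF. Qed.

Lemma swap_snoc m (x : {ffun 'I_m -> E}) v i j :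
  swap (snoc x v) (lift ord_max i) (lift ord_max j) = snoc (swap x i j) v.
Proof.
apply/ffunP => l; rewrite ffunE; case: (unliftP ord_max l) => [l'|] ->.
  by rewrite -(inj_tperm _ _ _ (@lift_inj _ ord_max)) !snoc_lift ffunE.
by rewrite tpermD ?snoc_max // eq_sym eq_liftF.
Qed.

Lemma fmap_upd (f : E -> F) m (x : {ffun 'I_m -> E}) i z :
  fmap f (upd x i z) = upd (fmap f x) i (f z).
Proof. by apply/ffunP => j; rewrite !ffunE; case: eqP. Qed.

Lemma fmap_omit (f : E -> F) m (x : {ffun 'I_m.+1 -> E}) i :
  fmap f (omit i x) = omit i (fmap f x).
Proof. by apply/ffunP => j; rewrite !ffunE. Qed.

Lemma fmap_snoc (f : E -> F) m (x : {ffun 'I_m -> E}) z :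
  fmap f (snoc x z) = snoc (fmap f x) (f z).
Proof. by apply/ffunP => j; rewrite !ffunE; case: unliftP => //= l _; rewrite ffunE. Qed.

Lemma fmap_fcons (f : E -> F) m (x : {ffun 'I_m -> E}) z :
  fmap f (fcons z x) = fcons (f z) (fmap f x).
Proof. by apply/ffunP => j; rewrite !ffunE; case: unliftP => //= l _; rewrite ffunE. Qed.

Lemma fmap_swap (f : E -> F) m (x : {ffun 'I_m -> E}) i j :
  fmap f (swap x i j) = swap (fmap f x) i j.
Proof. by apply/ffunP => l; rewrite !ffunE. Qed.

End TupleLemmas.

(** * Degrees of tuples and their partial sums *)

Lemma widen_lift_max m (i : 'I_m) : widen_ord (leqnSn m) i = lift ord_max i.
Proof. exact/val_inj/esym/lift_max. Qed.

Lemma deg_snoc m (d : {ffun 'I_m -> bool}) e : deg (snoc d e) = (deg d + e)%N.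
Proof.
rewrite /deg big_ord_recr /= snoc_max; congr (_ + _)%N.
by apply: eq_bigr => i _; rewrite widen_lift_max snoc_lift.
Qed.

Lemma deg_lt_snoc m (d : {ffun 'I_m -> bool}) e (i : nat) :
  (i <= m)%N -> deg_lt (snoc d e) i = deg_lt d i.
Proof.
move=> le_im; rewrite /deg_lt big_mkcond big_ord_recr /= ltnNge le_im addn0.
rewrite [RHS]big_mkcond /=.
by apply: eq_bigr => j _; rewrite widen_lift_max snoc_lift.
Qed.

Lemma deg_lt_size m (d : {ffun 'I_m -> bool}) : deg_lt d m = deg d.
Proof. by apply: eq_bigl => l; rewrite ltn_ord. Qed.

Lemma deg_split m (d : {ffun 'I_m -> bool}) (i : 'I_m) :
  deg d = (deg_lt d i + d i + deg_gt d i)%N.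
Proof.
rewrite /deg (bigID (fun l : 'I_m => l < i)%N) /= -addnA; congr (_ + _)%N.
rewrite (bigD1 i) /= ?ltnn //; congr (_ + _)%N.
by apply: eq_bigl => l; rewrite -val_eqE /=; lia.
Qed.

Lemma deg_gt0_fcons m (d : {ffun 'I_m -> bool}) e :
  deg_gt (fcons e d) 0 = deg d.
Proof.
rewrite /deg_gt big_mkcond big_ord_recl /= add0n.
by apply: eq_bigr => i _; rewrite ffunE liftK.
Qed.

Lemma deg_gt_upd m (d : {ffun 'I_m -> bool}) (i : 'I_m) e :
  deg_gt (upd d i e) i = deg_gt d i.
Proof.
by apply: eq_bigr => l lt_il; rewrite ffunE -val_eqE gtn_eqF.
Qed.

(** * Homogeneous tuples, and signs from moving arguments of super-skew-symmetric maps *)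

Section Homogeneous.
Variables (K : fieldType) (U W : superspace K).

Lemma homogs_snoc m d (x : {ffun 'I_m -> U}) e z :
  homogs d x -> homog e z -> homogs (snoc d e) (snoc x z).
Proof.
move=> dx ez i; case: (unliftP ord_max i) => [j|] ->; first by rewrite !snoc_lift.
by rewrite !snoc_max.
Qed.

Lemma homogs_fcons m d (x : {ffun 'I_m -> U}) e z :
  homogs d x -> homog e z -> homogs (fcons e d) (fcons z x).
Proof.
by move=> dx ez i; rewrite !ffunE; case: unliftP => /= [j|] _.
Qed.

Lemma homogs_omit m d (x : {ffun 'I_m.+1 -> U}) i :
  homogs d x -> homogs (omit i d) (omit i x).
Proof. by move=> dx j; rewrite !ffunE. Qed.

Lemma homogs_upd m d (x : {ffun 'I_m -> U}) i e z :
  homogs d x -> homog e z -> homogs (upd d i e) (upd x i z).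
Proof. by move=> dx ez j; rewrite !ffunE; case: ifP. Qed.

Lemma homogs_fmap (f : U -> W) m d (x : {ffun 'I_m -> U}) :
  even_map f -> homogs d x -> homogs d (fmap f x).
Proof. by move=> fE dx j; rewrite !ffunE; apply: fE. Qed.

(** Serves to prove representation axioms (b) and (c), which range over arbitrary vectors, from
    computations whose signs involve the degree of the vector. *)
Lemma superspace_ind (P : U -> Prop) :
  (forall u v, P u -> P v -> P (u + v)) ->
  (forall e u, homog e u -> P u) -> forall u, P u.
Proof.
move=> PD Ph u; have [u0 [u1 [h0 h1 ->]]] := homog_add u.
by apply: PD; [apply: Ph h0 | apply: Ph h1].
Qed.

(** The entry of index [i] passes its [m - i] right neighbours one at a time; passing the one of
    index [l] costs the sign [-1] and the sign with exponent [d i * d l]. *)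
Lemma super_skew_to_last m (f : {ffun 'I_m.+1 -> U} -> W) d x (i : 'I_m.+1) :
  super_skew m.+1 f -> homogs d x ->
  f x = ((-1) ^+ (m - i + d i * deg_gt d i) : K) *: f (snoc (omit i x) (x i)).
Proof.
move=> fS; have [r] := ubnP (m - i); elim: r d x i => // r IHr d x i lt_r dx.
have [i_max|lt_im] := eqVneq (i : nat) m.
  have -> : i = ord_max by apply/val_inj.
  rewrite (_ : omit ord_max x = init x) // snoc_init subnn add0n /deg_gt.
  rewrite big_pred0 ?muln0 ?expr0 ?scale1r // => l /=.
  by rewrite ltnNge -ltnS ltn_ord.
have {}lt_im : (i < m)%N by rewrite ltn_neqAle lt_im -ltnS ltn_ord.
have lt_i1 : (i.+1 < m.+1)%N by [].
pose j := Ordinal lt_i1.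
have ij : i != j by rewrite -val_eqE /= neq_ltn ltnSn.
have dx' : homogs (swap d i j) (swap x i j) by move=> l; rewrite !ffunE.
have := fS i j erefl lt_i1 x _ _ (dx i) (dx j).
rewrite (IHr _ _ j _ dx'); last first.
  by move: lt_r lt_im => /=; lia.
(* After one exchange the moving entry has index [j], so deleting it leaves the same remaining
   entries in the same order. *)
have -> : omit j (swap x i j) = omit i x.
  apply/ffunP => l; rewrite !ffunE; congr (x _).
  apply/val_inj; case: tpermP => [/(congr1 val)|/(congr1 val)|].
  - by rewrite /= /bump; lia.
  - by rewrite /= /bump; lia.
  - by move=> /eqP + /eqP; rewrite -!val_eqE /= /bump; lia.
have -> : swap x i j j = x i by rewrite ffunE tpermR.
have -> : swap d i j j = d i by rewrite ffunE tpermR.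
have -> : deg_gt (swap d i j) j = deg_gt d j.
  apply: eq_bigr => l /= lt_jl.
  by rewrite ffunE tpermD // -val_eqE /=; lia.
have -> : deg_gt d i = (d j + deg_gt d j)%N.
  rewrite /deg_gt (bigD1 j) //=; congr (_ + _)%N.
  by apply: eq_bigl => l; rewrite -val_eqE /=; lia.
move=> f_swap.
(* The exponent splits into the cost of the first exchange and that of the remaining ones; the
   former sign meets its own copy in [f_swap], and their product is 1. *)
have -> : (m - i + d i * (d j + deg_gt d j)
           = (d i * d j).+1 + (m - j + d i * deg_gt d j))%N.
  by rewrite mulnDr /=; lia.
rewrite exprD -scalerA f_swap scalerA exprS mulN1r mulrNN -expr2 sqrr_sign.
by rewrite scale1r.
Qed.

Lemma super_skew_fcons m (f : {ffun 'I_m.+1 -> U} -> W) d x e z :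
  super_skew m.+1 f -> homogs d x -> homog e z ->
  f (fcons z x) = ((-1) ^+ (m + e * deg d) : K) *: f (snoc x z).
Proof.
move=> fS dx ez; have := super_skew_to_last ord0 fS (homogs_fcons dx ez).
by rewrite omit0_fcons !fcons0 deg_gt0_fcons subn0.
Qed.

(** Needed for Jacobi summands, where an inner bracket replaces entry [i]: the sign depends only on
    the new degree and on the untouched entries to the right. *)
Lemma super_skew_upd m (f : {ffun 'I_m.+1 -> U} -> W) d x e z i :
  super_skew m.+1 f -> homogs d x -> homog e z ->
  f (upd x i z)
  = ((-1) ^+ (m - i + e * deg_gt d i) : K) *: f (snoc (omit i x) z).
Proof.
move=> fS dx ez; have := super_skew_to_last i fS (homogs_upd i dx ez).
by rewrite omit_upd deg_gt_upd !ffunE eqxx.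
Qed.

Lemma super_skew_snoc_snoc m (f : {ffun 'I_m.+2 -> U} -> W) x a b u v :
  super_skew m.+2 f -> homog a u -> homog b v ->
  f (snoc (snoc x u) v) = - ((-1) ^+ (a * b) : K) *: f (snoc (snoc x v) u).
Proof.
(* [i] is the last but one index; its successor is [ord_max]. *)
move=> fS au bv; pose i : 'I_m.+2 := lift ord_max ord_max.
have ij : (ord_max : 'I_m.+2) = i.+1 :> nat by rewrite /i /= /bump; lia.
have := fS i ord_max ij (ltnSn _) (snoc (snoc x v) u) b a.
rewrite snoc_max snoc_lift snoc_max mulnC => <- //; congr (f _).
apply/ffunP => j; rewrite [RHS]ffunE.
case: tpermP => [->|->|/eqP + /eqP].
- by rewrite /i snoc_max snoc_lift snoc_max.
- by rewrite /i snoc_max snoc_lift snoc_max.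
case: (unliftP ord_max j) => [l|] ->; last by rewrite eqxx.
rewrite !snoc_lift (inj_eq lift_inj).
by case: (unliftP ord_max l) => [l'|] ->; rewrite ?eqxx // !snoc_lift.
Qed.

Lemma super_skewW p m (f : {ffun 'I_m -> U} -> W) :
  (p <= m)%N -> super_skew m f -> super_skew p f.
Proof. by move=> le_pm fS i j ij lt_jp; apply: fS => //; apply: leq_trans le_pm. Qed.

Lemma super_skew_snoc m (f : {ffun 'I_m.+1 -> U} -> W) v :
  super_skew m f -> super_skew m (fun x => f (snoc x v)).
Proof.
move=> fS i j ij lt_jm x a b ax bx; rewrite -swap_snoc.
by apply: (fS _ _ _ _ _ a b); rewrite ?lift_max ?snoc_lift.
Qed.

Lemma multilinear_snoc m (f : {ffun 'I_m.+1 -> U} -> W) v :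
  multilinear f -> multilinear (fun x => f (snoc x v)).
Proof. by move=> fL x i a u w; rewrite -!upd_snoc fL. Qed.

Lemma multilinear_last m (f : {ffun 'I_m.+1 -> U} -> W) x :
  multilinear f -> linear (fun v => f (snoc x v)).
Proof.
move=> fL a u w; have := fL (snoc x 0) ord_max a u w.
by rewrite !upd_snoc_max.
Qed.
End Homogeneous.

(** Reduces the comparison of two signs to a Boolean identity, which a case analysis on parities
    settles. *)
Lemma signr_eq_odd (R : pzRingType) (m n : nat) :
  odd m = odd n -> (-1) ^+ m = (-1) ^+ n :> R.
Proof. by move=> mn; rewrite -signr_odd mn signr_odd. Qed.

(** * The adjoint representation *)

Section Adjoint.
Variables (K : fieldType) (k : nat) (A : superspace K).
Variables (br : {ffun 'I_k.+2 -> A} -> A) (alpha : {linear A -> A}).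
Hypothesis hA : n_hom_lie br alpha.

Lemma adjoint_linear x : linear (adjoint br x).
Proof. exact/multilinear_last/(hl_linear hA). Qed.

Lemma adjointZ x c v : adjoint br x (c *: v) = c *: adjoint br x v.
Proof. exact: (scalable_linear (adjoint_linear x)). Qed.

Lemma adjointD x u v : adjoint br x (u + v) = adjoint br x u + adjoint br x v.
Proof. by have := adjoint_linear x 1 u v; rewrite !scale1r. Qed.

Lemma br_even d x : homogs d x -> homog (odd (deg d)) (br x).
Proof. exact: (hl_even hA). Qed.

Lemma adjoint_rep_b dx (x : {ffun 'I_k.+1 -> A}) dy (y : {ffun 'I_k.+1 -> A}) e v :
  homogs dx x -> homogs dy y -> homog e v ->
  adjoint br (fmap alpha x) (adjoint br y v)
    - ((-1) ^+ (deg dx * deg dy) : K)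
      *: adjoint br (fmap alpha y) (adjoint br x v) =
  \sum_(i < k.+1) ((-1) ^+ (deg dx * deg_lt dy i) : K) *:
    adjoint br (upd (fmap alpha y) i (br (snoc x (y i)))) (alpha v).
Proof.
move=> xd yd ve; rewrite /adjoint (hl_jacobi hA xd (homogs_snoc yd ve)).
(* The last Jacobi summand, where the inner bracket contains [v], is exactly the term subtracted on
   the left. *)
rewrite big_ord_recr /= fmap_snoc snoc_max upd_snoc_max deg_lt_snoc //.
rewrite deg_lt_size addrK; apply: eq_bigr => i _.
by rewrite widen_lift_max deg_lt_snoc 1?ltnW // upd_snoc snoc_lift.
Qed.

Lemma adjoint_rep_c dx (x : {ffun 'I_k -> A}) dy (y : {ffun 'I_k.+2 -> A}) e v :
  homogs dx x -> homogs dy y -> homog e v ->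
  adjoint br (snoc (fmap alpha x) (br y)) (alpha v) =
  \sum_(i < k.+2)
    ((-1) ^+ (k.+1 - i)
     * (-1) ^+ (deg dx * (deg dy + dy i) + dy i * deg_gt dy i) : K) *:
    adjoint br (fmap alpha (omit i y)) (adjoint br (snoc x (y i)) v).
Proof.
move=> xd yd ve; rewrite /adjoint.
(* Exchanging [br y] with [alpha v] puts [br y] last, so that Hom-Jacobi applies with [snoc x v] as
   the acting tuple. *)
rewrite (super_skew_snoc_snoc _ (hl_skew hA) (br_even yd) (hl_alpha_even hA ve)).
rewrite -fmap_snoc (hl_jacobi hA (homogs_snoc xd ve) yd) scaler_sumr.
apply: eq_bigr => i _.
(* In each summand the inner bracket moves from position [i] to the end; inside it, [v] and [y i]
   are then exchanged. *)
rewrite (super_skew_upd _ (hl_skew hA) (homogs_fmap (hl_alpha_even hA) yd)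
          (br_even (homogs_snoc (homogs_snoc xd ve) (yd i)))) -fmap_omit.
rewrite (super_skew_snoc_snoc _ (hl_skew hA) ve (yd i)).
rewrite -[br (snoc (fmap alpha _) _)]/(adjoint br _ _).
rewrite adjointZ /adjoint !scalerA; congr (_ *: _).
rewrite !mulrN !mulNr opprK -!exprD; apply: signr_eq_odd.
(* The two minus signs have cancelled. The degree [e] of [v] is multiplied by [deg dy] once from the
   first exchange and once in total from the other moves, so it vanishes modulo 2. *)
rewrite !deg_snoc (deg_split dy i) !(oddD, oddM, oddb).
move: (odd (deg dx)) (odd (deg_lt dy i)) (odd (deg_gt dy i)) (dy i) e {ve}.
move: (odd (k.+1 - i)).
by do 6!case.
Qed.

Lemma adjoint_representation : representation br alpha (adjoint br) alpha.
Proof.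
split.
- exact: adjoint_linear.
- by move=> v; apply: multilinear_snoc (hl_linear hA).
- by move=> dx x e v xd ve; rewrite -deg_snoc; apply/br_even/homogs_snoc.
- by move=> v; apply/super_skew_snoc/super_skewW/(hl_skew hA).
- exact: (hl_alpha_even hA).
- by move=> x v; rewrite /adjoint (hl_mult hA) fmap_snoc.
(* Both sides of (b), and likewise of (c), are additive in [v], so homogeneous [v] suffices. *)
- move=> dx x dy y v xd yd; elim/superspace_ind: v => [u v IHu IHv|e v].
    rewrite linearD /= !adjointD scalerDr opprD addrACA IHu IHv -big_split /=.
    by apply: eq_bigr => i _; rewrite adjointD scalerDr.
  exact: adjoint_rep_b.
- move=> dx x dy y v xd yd; elim/superspace_ind: v => [u v IHu IHv|e v].
    rewrite linearD /= adjointD IHu IHv -big_split /=.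
    by apply: eq_bigr => i _; rewrite !adjointD scalerDr.
  exact: adjoint_rep_c.
Qed.

End Adjoint.

(** * The n-Hom-pre-Lie structure induced by an O-operator *)

Section InducedHomPreLie.
Variables (K : fieldType) (k : nat) (A V : superspace K).
Variables (br : {ffun 'I_k.+2 -> A} -> A) (alpha : {linear A -> A}).
Variables (rho : {ffun 'I_k.+1 -> A} -> V -> V) (alphaV : {linear V -> V}).
Variable T : {linear V -> A}.
Hypothesis hA : n_hom_lie br alpha.
Hypothesis rhoP : representation br alpha rho alphaV.
Hypothesis TP : O_operator br alpha rho alphaV T.

Let pr (u : {ffun 'I_k.+2 -> V}) := rho (fmap T (init u)) (u ord_max).

Lemma prE x v : pr (snoc x v) = rho (fmap T x) v.
Proof. by rewrite /pr init_snoc snoc_max. Qed.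

Lemma fmapT_alphaV m (x : {ffun 'I_m -> V}) :
  fmap T (fmap alphaV x) = fmap alpha (fmap T x).
Proof. by apply/ffunP => i; rewrite !ffunE (oop_comm TP). Qed.

(** By [prE], the C-bracket of [pr] is the very sum under [T] in the O-operator equation. *)
Lemma O_operator_c_bracket d x : homogs d x -> T (c_bracket pr d x) = br (fmap T x).
Proof.
move=> xd; rewrite (oop_eq TP xd); congr (T _).
by apply: eq_bigr => i _; rewrite prE.
Qed.

Lemma O_operator_multilinear : multilinear pr.
Proof.
move=> x i a u v; rewrite -(snoc_init x).
case: (unliftP ord_max i) => [j|] ->.
  by rewrite !upd_snoc !prE !fmap_upd linearP (rep_linear rhoP).
by rewrite !upd_snoc_max !prE (rep_endo rhoP).
Qed.

Lemma O_operator_even : even_multi pr.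
Proof.
move=> d x xd; rewrite -(snoc_init d) deg_snoc.
apply: (rep_even rhoP) (xd _).
exact/(homogs_fmap (oop_even TP))/homogs_omit.
Qed.

Lemma O_operator_skew : super_skew k.+1 pr.
Proof.
move=> i j ij lt_jk x a b; rewrite -(snoc_init x).
case: (unliftP ord_max i) ij => [i'|] -> ij; last first.
  by move: lt_jk; rewrite ij /= ltnNge leqW.
case: (unliftP ord_max j) ij lt_jk => [j'|] ->; last by rewrite ltnn.
rewrite !lift_max => ij lt_jk; rewrite !snoc_lift swap_snoc !prE fmap_swap => ai bj.
by apply: (rep_skew rhoP) => //; rewrite ffunE; apply: (oop_even TP).
Qed.

(** This is axiom (b) for the [T]-images of [x] and [init y], applied to the last entry of [y], with
    the subtracted term carried to the right. *)
Lemma O_operator_pl_left dx (x : {ffun 'I_k.+1 -> V})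
    dy (y : {ffun 'I_k.+2 -> V}) :
  homogs dx x -> homogs dy y ->
  pr (snoc (fmap alphaV x) (pr y)) =
  \sum_(i < k.+1) ((-1) ^+ (deg dx * deg_lt dy i) : K) *:
    pr (upd (fmap alphaV y) (lift ord_max i)
         (c_bracket pr (snoc dx (dy (lift ord_max i)))
                       (snoc x (y (lift ord_max i)))))
  + ((-1) ^+ (deg dx * deg_lt dy k.+1) : K) *:
    pr (snoc (fmap alphaV (init y)) (pr (snoc x (y ord_max)))).
Proof.
move=> xd yd; have TE := homogs_fmap (oop_even TP).
have yd' : homogs (init dy) (init y) by apply: homogs_omit.
have := rep_b rhoP (y ord_max) (TE _ _ _ xd) (TE _ _ _ yd').
rewrite !prE !fmapT_alphaV => /(canRL (subrK _)) ->.
(* The bound includes [k.+1]: there the partial degree is the whole degree of [init dy], as (b)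
   requires. *)
have lt_init i : (i <= k.+1)%N -> deg_lt dy i = deg_lt (init dy) i.
  by move=> le_ik; rewrite -[in LHS](snoc_init dy) deg_lt_snoc.
rewrite lt_init // deg_lt_size; congr (_ + _).
apply: eq_bigr => i _; rewrite lt_init 1?ltnW //.
rewrite -[in fmap alphaV y](snoc_init y) fmap_snoc upd_snoc prE fmap_upd fmapT_alphaV.
rewrite O_operator_c_bracket; last exact: homogs_snoc.
by rewrite fmap_snoc ffunE initE.
Qed.

(** This is axiom (c) with the [T]-image of [init y] as its first [k] arguments, applied to the last
    entry of [y]. *)
Lemma O_operator_pl_right dx (x : {ffun 'I_k.+2 -> V})
    dy (y : {ffun 'I_k.+1 -> V}) :
  homogs dx x -> homogs dy y ->
  pr (fcons (c_bracket pr dx x) (fmap alphaV y)) =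
  \sum_(i < k.+2) ((-1) ^+ (k.+1 - i) * (-1) ^+ (dx i * deg_gt dx i) : K) *:
    pr (snoc (fmap alphaV (omit i x)) (pr (fcons (x i) y))).
Proof.
move=> xd yd; have TE := homogs_fmap (oop_even TP).
have Tx := TE _ _ _ xd.
have Ty : homogs (init dy) (fmap T (init y)) by apply/TE/homogs_omit.
have aTy := homogs_fmap (hl_alpha_even hA) Ty.
have rho_skew v := rep_skew rhoP v.
have prfc z (w : {ffun 'I_k.+1 -> V}) :
  pr (fcons z w) = rho (fcons (T z) (fmap T (init w))) (w ord_max).
  by rewrite /pr init_fcons fcons_max fmap_fcons.
rewrite prfc O_operator_c_bracket // ffunE /init -fmap_omit fmapT_alphaV.
(* Axiom (c) has the bracket in the last slot of [rho]; the move costs [k + deg dx * deg (init dy)]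
   modulo 2. *)
rewrite (super_skew_fcons (rho_skew _) aTy (hl_even hA Tx)).
rewrite (rep_c rhoP _ Ty Tx) scaler_sumr; apply: eq_bigr => i _.
rewrite prE prfc fmapT_alphaV.
(* On the right, [T (x i)] likewise moves from first to last, at cost [k + dx i * deg (init dy)].
   Together the two costs match the factor [deg (init dy) * (deg dx + dx i)] from (c). *)
rewrite (super_skew_fcons (rho_skew _) Ty (oop_even TP (xd i))).
rewrite (scalable_linear (rep_endo rhoP _)) !scalerA !fmap_omit ffunE.
congr (_ *: _); rewrite -!exprD; apply: signr_eq_odd.
rewrite !(oddD, oddM, oddb).
case: (odd k) (odd (k.+1 - i)) (odd (deg dx)) (dx i) => [] [] [] [].
all: by case: (odd (deg (init dy))); case: (odd (deg_gt dx i)).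
Qed.

Lemma O_operator_n_hom_pre_lie : n_hom_pre_lie pr alphaV.
Proof.
split; [exact: O_operator_multilinear | exact: O_operator_even
  | exact: O_operator_skew | exact: (rep_alphaV_even rhoP)
  | exact: O_operator_pl_left | exact: O_operator_pl_right].
Qed.

End InducedHomPreLie.

Theorem proposition3p3 (K : closedFieldType) (charK : [pchar K] =i pred0)
    (k : nat) (A : superspace K) (br : {ffun 'I_k.+2 -> A} -> A)
    (alpha : {linear A -> A}) (hA : n_hom_lie br alpha) :
  (forall (V : superspace K) (rho : {ffun 'I_k.+1 -> A} -> V -> V)
          (alphaV : {linear V -> V}) (T : {linear V -> A}),
     representation br alpha rho alphaV ->
     O_operator br alpha rho alphaV T ->
     n_hom_pre_lie (fun u : {ffun 'I_k.+2 -> V} =>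
       rho (fmap T (init u)) (u ord_max)) alphaV)
  /\
  (forall P : {linear A -> A},
     rota_baxter0 br alpha P ->
     n_hom_pre_lie (fun x : {ffun 'I_k.+2 -> A} =>
       br (snoc (fmap P (init x)) (x ord_max))) alpha).
Proof.
split=> [V rho alphaV T|P]; first exact: O_operator_n_hom_pre_lie.
(* Here [V] is [A] and [rho] is [adjoint br], which unfolds to the bracket in the statement. *)
exact: O_operator_n_hom_pre_lie hA (adjoint_representation hA).
Qed.
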